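(* Let $m,\ell,m',\ell'$ be four positive integers. The groups $G(m,\ell)$ and $G(m',\ell')$ are isomorphic if and only if one of the following holds: (1) $1\in \{m,\ell\}$ and $1\in \{m',\ell'\}$; in this case, $G(m,\ell)\simeq G(m',\ell')\simeq \mathbb{Z}$. (2) $(m',\ell')\in \{(m,\ell),(\ell,m)\}$.
   Context: For positive integers $m,\ell$, consider letters $a_0,\ldots,a_{m-1}$, and set $a_j:=a_{j'}$ for $j\in\mathbb{Z}$, where $j'\in\{0,\ldots,m-1\}$ and $j\equiv j' \pmod m$. For $i\in\mathbb{Z}$ and $p\geq 1$ let $s(i,p)=a_ia_{i+1}\cdots a_{i+p-1}$ (a product of $p$ consecutive letters). The circular group $G(m,\ell)$ is the group with generators $a_0,\ldots,a_{m-1}$ and relations $s(i,\ell)=s(i+1,\ell)$ for all $i\in\{0,\ldots,m-1\}$. *)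

(* Defs.v *)
From HB Require Import structures.
From mathcomp Require Import all_boot all_order all_algebra.
From mathcomp Require Import generic_quotient boolp.

Set Implicit Arguments.
Unset Strict Implicit.
Unset Printing Implicit Defensive.

Import GRing.Theory Num.Theory.

Local Open Scope group_scope.
Local Open Scope quotient_scope.

Definition isomorphic (G H : groupType) : Prop :=
  exists f : {multiplicative G -> H}, bijective f.

(* Words over X and its formal inverses: (x, true) is x, (x, false) is x^-1. *)
Definition word (X : Type) : Type := seq (X * bool).

Definition winv (X : Type) (w : word X) : word X :=
  rev [seq (a.1, ~~ a.2) | a <- w].

(* The least congruence on words that identifies u and v whenever R u v and
   makes (x, false) a two-sided inverse of (x, true). *)
Inductive pres_eq (X : Type) (R : word X -> word X -> Prop) :
    word X -> word X -> Prop :=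
| pres_refl u : pres_eq R u u
| pres_sym u v : pres_eq R u v -> pres_eq R v u
| pres_trans v u w : pres_eq R u v -> pres_eq R v w -> pres_eq R u w
| pres_cat u u' v v' :
    pres_eq R u u' -> pres_eq R v v' -> pres_eq R (u ++ v) (u' ++ v')
| pres_cancel x b : pres_eq R [:: (x, b); (x, ~~ b)] [::]
| pres_rel u v : R u v -> pres_eq R u v.

Lemma winvK (X : Type) : involutive (@winv X).
Proof.
move=> w; rewrite /winv map_rev revK -map_comp -[RHS]map_id.
by apply: eq_map => -[x b] /=; rewrite negbK.
Qed.

Lemma pres_mulVw (X : Type) (R : word X -> word X -> Prop) (w : word X) :
  pres_eq R (winv w ++ w) [::].
Proof.
elim: w => [|[x b] w IHw]; first exact: pres_refl.
rewrite /winv /= rev_cons -cats1 -catA /=.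
apply: pres_trans IHw; apply: pres_cat; first exact: pres_refl.
have := pres_cancel R x (~~ b); rewrite negbK => xVx.
exact: (pres_cat xVx (pres_refl R w)).
Qed.

Lemma pres_mulwV (X : Type) (R : word X -> word X -> Prop) (w : word X) :
  pres_eq R (w ++ winv w) [::].
Proof. by have := pres_mulVw R (winv w); rewrite winvK. Qed.

Lemma pres_eq_winv (X : Type) (R : word X -> word X -> Prop) (u v : word X) :
  pres_eq R u v -> pres_eq R (winv u) (winv v).
Proof.
move=> uv; apply: (@pres_trans _ _ (winv u ++ v ++ winv v)).
  rewrite -[X in pres_eq R X](cats0 (winv u)).
  by apply: pres_cat (pres_refl _ _) (pres_sym (pres_mulwV R v)).
rewrite catA -[X in pres_eq R _ X]cat0s.
apply: pres_cat (pres_refl _ _); apply: pres_trans (pres_mulVw R u).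
exact: pres_cat (pres_refl _ _) (pres_sym uv).
Qed.

Section Presented.
Variables (X : choiceType) (R : word X -> word X -> Prop).

Definition pres_eqb : rel (word X) := fun u v => `[< pres_eq R u v >].

Lemma pres_eqb_equiv : equiv_class_of pres_eqb.
Proof.
split=> [u|u v|v u w].
- by apply/asboolP; exact: pres_refl.
- by apply/asboolP/asboolP; exact: pres_sym.
- by move=> /asboolP uv /asboolP vw; apply/asboolP; exact: pres_trans uv vw.
Qed.

Canonical pres_equiv := EquivRelPack pres_eqb_equiv.

(* The group < X | u = v whenever R u v >. *)
Definition presented : Type := {eq_quot pres_equiv}.

HB.instance Definition _ := Choice.on presented.
HB.instance Definition _ := Quotient.on presented.
HB.instance Definition _ := EqQuotient.on presented.

Lemma presentedP (u v : word X) :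
  \pi_presented u = \pi_presented v <-> pres_eq R u v.
Proof. by split=> [/eqmodP /asboolP|uv] //; apply/eqmodP/asboolP. Qed.

Definition pres_mul (g h : presented) : presented :=
  \pi_presented (repr g ++ repr h).
Definition pres_inv (g : presented) : presented := \pi_presented (winv (repr g)).
Definition pres_one : presented := \pi_presented [::].

Lemma pres_mulE (u v : word X) :
  pres_mul (\pi_presented u) (\pi_presented v) = \pi_presented (u ++ v).
Proof. by apply/presentedP/pres_cat; apply/presentedP; rewrite reprK. Qed.

Lemma pres_invE (u : word X) :
  pres_inv (\pi_presented u) = \pi_presented (winv u).
Proof. by apply/presentedP/pres_eq_winv/presentedP; rewrite reprK. Qed.

Lemma pres_mulA : associative pres_mul.
Proof.
move=> g h k; rewrite -[g]reprK -[h]reprK -[k]reprK.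
rewrite (pres_mulE (repr h) (repr k)) (pres_mulE (repr g) (repr h)).
by rewrite !pres_mulE catA.
Qed.

Lemma pres_mul1g : left_id pres_one pres_mul.
Proof. by move=> g; rewrite -[g]reprK pres_mulE. Qed.

Lemma pres_mulg1 : right_id pres_one pres_mul.
Proof. by move=> g; rewrite -[g]reprK pres_mulE cats0. Qed.

Lemma pres_mulVg : left_inverse pres_one pres_inv pres_mul.
Proof.
by move=> g; rewrite -[g]reprK pres_invE pres_mulE; apply/presentedP/pres_mulVw.
Qed.

Lemma pres_mulgV : right_inverse pres_one pres_inv pres_mul.
Proof.
by move=> g; rewrite -[g]reprK pres_invE pres_mulE; apply/presentedP/pres_mulwV.
Qed.

HB.instance Definition _ := isGroup.Build presented
  pres_mulA pres_mul1g pres_mulg1 pres_mulVg pres_mulgV.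

End Presented.

Section Circular.
Variables (m : nat) (m_gt0 : (0 < m)%N).

Fact letter_subproof (j : int) : (`|(j %% m)%Z| < m)%N.
Proof.
have m0 : m%:Z%R != 0%R by rewrite -lt0n.
by rewrite -ltz_nat gez0_abs ?modz_ge0 ?ltz_pmod.
Qed.

(* a_j = a_j' for the residue j' in {0, ..., m - 1} of j modulo m. *)
Definition letter (j : int) : 'I_m := Ordinal (letter_subproof j).

Definition s (i : int) (p : nat) : word 'I_m :=
  [seq (letter (i + k%:Z)%R, true) | k <- iota 0 p].

Definition circular_rel (l : nat) (u v : word 'I_m) : Prop :=
  exists i : 'I_m, u = s i%:Z%R l /\ v = s (i%:Z + 1)%R l.

Definition circular_group (l : nat) : groupType := presented (circular_rel l).

End Circular.

(* The additive group of the integers, written multiplicatively. *)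
Definition Zgroup : groupType := Algebra.to_multiplicative int.

(* Main.v *)
From HB Require Import structures.
From mathcomp Require Import all_boot all_order all_algebra all_fingroup.
From mathcomp Require Import cyclic abelian frobenius finfield.
From mathcomp Require Import generic_quotient boolp zify ring.
Require Import Defs.

(** A map x from the generators of G(m,l) to a group H, extended to an
    m-periodic sequence, is best understood through its partial products
    P_i = x_0 ... x_(i-1).  Periodicity of x says that P_(i+m) = A P_i for some
    A, and the defining relations say that P_(i+l) = P_i B for some B.

    This description exchanges m and l when every P_i is replaced by its
    inverse, which gives an isomorphism between G(m,l) and G(l,m)
    ([circular_group_swap]).  As G(1,l) is visibly infinite cyclic
    ([circular_group_1]), every isomorphism claimed by the theorem follows.

    For the converse, isomorphic groups have equally many homomorphisms to any
    finite group H.  Let m = m1 d and l = l1 d with m1 and l1 coprime.  The path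
    P is determined by A, B and P_0 = 1, P_1, ..., P_(d-1), and going around
    m l / d in the two possible ways shows that the only constraint is that
    A^l1 = B^m1 commutes with P_1, ..., P_(d-1)
    ([card_circular_reps_triples]).  Hence
      |Hom(G(m,l), H)| = sum_z r_l1(z) r_m1(z) |C(z)|^(d-1),
    where r_k(z) is the number of k-th roots of z ([card_torus_triples]).

    Take for H the group of affine maps of a finite field of q elements whose
    slope lies in the group of n-th roots of unity, with n | q - 1.  There roots
    and centralizers are given by linear equations over the field, so that the
    sum can be evaluated ([card_affine_triples]): it is an explicit function of
    q, n, d, a = gcd(l1,n) and b = gcd(m1,n).
    With n = 1 it equals q^d, so d is an invariant.  If d >= 2, taking n a
    multiple of m1 and l1, and q large, the value determines ab = m1 l1 and then
    a + b = m1 + l1 ([affine_count_pair]).  If d = 1, it only determines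
    (a - 1)(b - 1) ([affine_count_excess]), but for every n; this product
    vanishes for all n exactly when 1 is one of m1 and l1, and otherwise it
    first attains its largest value (m1 - 1)(l1 - 1) at n = m1 l1, which again
    gives both product and sum ([coprime_pair_of_excess]). *)

Set Implicit Arguments.
Unset Strict Implicit.
Unset Printing Implicit Defensive.

Import GRing.Theory Num.Theory.
Local Open Scope group_scope.

(** * Homomorphisms and isomorphisms *)

Lemma multiplicative1 (G H : groupType) (f : {multiplicative G -> H}) : f 1 = 1.
Proof. by apply: (mulgI (f 1)); rewrite -gmulfM !mulg1. Qed.

Lemma multiplicativeV (G H : groupType) (f : {multiplicative G -> H}) :
  {morph f : x / x^-1}.
Proof.
by move=> x; symmetry; apply: mulg1_eq; rewrite -gmulfM mulgV multiplicative1.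
Qed.

Lemma multiplicative_prod (G H : groupType) (f : {multiplicative G -> H})
    (I : Type) (r : seq I) (P : pred I) (E : I -> G) :
  f (\prod_(i <- r | P i) E i) = \prod_(i <- r | P i) f (E i).
Proof. by apply: big_morph; [exact: gmulfM|exact: multiplicative1]. Qed.

Lemma isomorphic_sym (G H : groupType) : isomorphic G H -> isomorphic H G.
Proof.
case=> f [g fK gK].
pose gM := isMultiplicative.Build H G g (can2_gmulfM fK gK).
pose g' : {multiplicative H -> G} := HB.pack g gM.
by exists g', f.
Qed.

Lemma isomorphic_trans (G H K : groupType) :
  isomorphic G H -> isomorphic H K -> isomorphic G K.
Proof.
by case=> f bf [g bg]; exists (g \o f : {multiplicative _ -> _}); exact: bij_comp.
Qed.

(** * The universal property of a presented group *)

(** The type [presented R] bundled with its group structure, so that it can be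
    used as the source of a homomorphism. *)
Definition pres_group (X : choiceType) (R : word X -> word X -> Prop) : groupType :=
  presented R.

Section Presentations.
Variables (X : choiceType) (R : word X -> word X -> Prop) (H : groupType).
Local Notation G := (pres_group R).
Local Notation pi := (\pi_(presented R)%qT).

Definition pgen (x : X) : G := pi [:: (x, true)].

Definition weval (f : X -> H) (w : word X) : H :=
  \prod_(a <- w) (if a.2 then f a.1 else (f a.1)^-1).

Lemma pi_cat u v : pi (u ++ v) = (pi u : G) * (pi v : G).
Proof. by rewrite -pres_mulE. Qed.

Lemma pi_positive (I : Type) (r : seq I) (f : I -> X) :
  pi [seq (f k, true) | k <- r] = \prod_(k <- r) pgen (f k).
Proof.
elim: r => [|k r IHr]; first by rewrite big_nil.
by rewrite big_cons -IHr -pi_cat.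
Qed.

Lemma pres_eq_weval (f : X -> H) :
    (forall u v, R u v -> weval f u = weval f v) ->
  forall u v, pres_eq R u v -> weval f u = weval f v.
Proof.
move=> fR u v; elim=> {u v} //.
- by move=> u v w _ -> _ ->.
- by move=> u u' v v' _ IHu _ IHv; rewrite /weval !big_cat -!/(weval f _) IHu IHv.
- move=> x [] /=; rewrite /weval !big_cons !big_nil /= mulg1;
  by rewrite ?mulgV ?mulVg.
Qed.

Lemma pres_hom (f : X -> H) :
    (forall u v, R u v -> weval f u = weval f v) ->
  exists phi : {multiplicative G -> H}, forall x, phi (pgen x) = f x.
Proof.
move=> fR; pose F (g : G) := weval f (repr g).
have FE u : F (pi u) = weval f u.
  by apply: pres_eq_weval => //; apply/presentedP; rewrite reprK.
have FM : {morph F : g h / g * h}.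
  move=> g h; rewrite -[g]reprK -[h]reprK -pi_cat !FE.
  by rewrite /weval big_cat.
pose phi : {multiplicative G -> H} :=
  HB.pack F (isMultiplicative.Build G H F FM).
by exists phi => x; rewrite /phi /= FE /weval big_seq1.
Qed.

Lemma pgenV x : pi [:: (x, false)] = (pgen x)^-1 :> G.
Proof.
by symmetry; apply: mulg1_eq; rewrite -pi_cat; apply/presentedP; apply: pres_cancel.
Qed.

Lemma pres_ind (P : G -> Prop) :
    P 1 -> (forall g x, P g -> P (g * pgen x)) ->
    (forall g x, P g -> P (g * (pgen x)^-1)) ->
  forall g, P g.
Proof.
move=> P1 Pr PV g; rewrite -[g]reprK; elim/last_ind: (repr g) => // w [x b] IHw.
by rewrite -cats1 pi_cat; case: b; [exact: Pr|rewrite pgenV; exact: PV].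
Qed.

Lemma pres_hom_eq (phi psi : {multiplicative G -> H}) :
  (forall x, phi (pgen x) = psi (pgen x)) -> phi =1 psi.
Proof.
move=> eq_gen; apply: pres_ind => [|g x IHg|g x IHg].
- by rewrite !multiplicative1.
- by rewrite !gmulfM IHg eq_gen.
by rewrite !gmulfM !multiplicativeV IHg eq_gen.
Qed.

End Presentations.

(** * Circular sequences and their partial products *)

Section Paths.
Variable H : groupType.
Implicit Types (x P : nat -> H) (A B : H).

(** These are exactly the sequences of images of a_0, a_1, a_2, ... under a
    homomorphism from G(m,l) to H. *)
Definition circular m l x :=
  (forall i, x (i + m)%N = x i) /\
  (forall i, \prod_(k < l) x (i + k)%N = \prod_(k < l) x (i.+1 + k)%N).

Lemma eq_circular m l x y : x =1 y -> circular m l x -> circular m l y.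
Proof.
move=> xy [per slide]; split=> i; first by rewrite -!xy.
by have := slide i; under eq_bigr do rewrite xy; under [RHS]eq_bigr do rewrite xy.
Qed.

Definition path_of x n : H := \prod_(k < n) x k.

Lemma path_ofD x i n : path_of x (i + n) = path_of x i * \prod_(k < n) x (i + k)%N.
Proof. by rewrite /path_of big_split_ord. Qed.

Lemma path_of0 x : path_of x 0 = 1. Proof. exact: big_ord0. Qed.

Lemma path_ofS x i : path_of x i.+1 = path_of x i * x i.
Proof. exact: big_ord_recr. Qed.

(** The first m factors of x_0 ... x_(i+m-1) form A = x_0 ... x_(m-1), and by
    periodicity the remaining ones are x_0, ..., x_(i-1). *)
Lemma circular_pathl m l x i : circular m l x ->
  path_of x (i + m) = path_of x m * path_of x i.
Proof.
case=> per _; rewrite addnC path_ofD; congr (_ * _).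
by apply: eq_bigr => k _; rewrite addnC per.
Qed.

(** The last l factors of x_0 ... x_(i+l-1) can be slid back to x_0 ... x_(l-1)
    by the relations of the circular group. *)
Lemma circular_pathr m l x i : circular m l x ->
  path_of x (i + l) = path_of x i * path_of x l.
Proof.
case=> _ slide; rewrite path_ofD; congr (_ * _).
elim: i => [|i IHi]; first exact: eq_bigr.
by rewrite -slide IHi.
Qed.

Lemma iter_pathl P A m n i : (forall j, P (j + m)%N = A * P j) ->
  P (i + n * m)%N = A ^+ n * P i.
Proof.
move=> Pm; elim: n => [|n IHn]; first by rewrite addn0 expg0 mul1g.
by rewrite mulSn addnCA addnC Pm IHn expgS mulgA.
Qed.

Lemma iter_pathr P B l n i : (forall j, P (j + l)%N = P j * B) ->
  P (i + n * l)%N = P i * B ^+ n.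
Proof.
move=> Pl; elim: n => [|n IHn]; first by rewrite addn0 expg0 mulg1.
by rewrite mulSn addnCA addnC Pl IHn expgSr mulgA.
Qed.

(** Inverse to [path_of], up to a left translation of the path. *)
Definition steps P i : H := (P i)^-1 * P i.+1.

Lemma prod_steps P i n : \prod_(k < n) steps P (i + k) = (P i)^-1 * P (i + n)%N.
Proof.
elim: n => [|n IHn]; first by rewrite big_ord0 addn0 mulVg.
by rewrite big_ord_recr /= IHn /steps mulgA mulgK addnS.
Qed.

Lemma path_of_steps P n : path_of (steps P) n = (P 0%N)^-1 * P n.
Proof. exact: (prod_steps P 0 n). Qed.

Lemma steps_circular m l P A B :
    (forall i, P (i + m)%N = A * P i) -> (forall i, P (i + l)%N = P i * B) ->
  circular m l (steps P).
Proof.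
move=> Pm Pl; split=> i.
  by rewrite /steps -addSn !Pm invgM -mulgA mulKg.
by rewrite !prod_steps !Pl !mulKg.
Qed.

Definition swap x := steps (fun i => (path_of x i)^-1).

(** Inverting the path turns left multiplication into right multiplication, and
    so exchanges the two conditions in the definition of a circular sequence. *)
Lemma swap_circular m l x : circular m l x -> circular l m (swap x).
Proof.
move=> cx; apply: (@steps_circular _ _ _ (path_of x l)^-1 (path_of x m)^-1) => i.
  by rewrite (circular_pathr _ cx) invgM.
by rewrite (circular_pathl _ cx) invgM.
Qed.

Lemma swap_swap x : swap (swap x) =1 x.
Proof.
move=> i; rewrite {1}/swap {1}/steps !path_of_steps path_of0 !invg1 !mul1g.
by rewrite !invgK path_ofS mulKg.
Qed.

Lemma eq_swap x y : x =1 y -> swap x =1 swap y.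
Proof.
move=> xy i; rewrite /swap /steps /path_of.
by congr (_ ^-1^-1 * _^-1); apply: eq_bigr.
Qed.

End Paths.

Lemma circular_morph (G H : groupType) (phi : {multiplicative G -> H}) m l x :
  circular m l x -> circular m l (phi \o x).
Proof.
case=> per slide; split=> i /=; first by rewrite per.
by have := congr1 phi (slide i); rewrite !multiplicative_prod.
Qed.

Lemma swap_morph (G H : groupType) (phi : {multiplicative G -> H}) x i :
  phi (swap x i) = swap (phi \o x) i.
Proof. by rewrite /swap /steps gmulfM !multiplicativeV !multiplicative_prod. Qed.

(** * Circular groups *)

Section CircularGroup.
Variables (m : nat) (m_gt0 : (0 < m)%N) (l : nat).
Local Notation G := (circular_group m_gt0 l).

(** Natural indices suffice: the relations of the circular group involve only
    letters with a nonnegative index. *)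
Definition nletter (i : nat) : 'I_m := Ordinal (ltn_pmod i m_gt0).

Lemma letter_nat (i : nat) : letter m_gt0 i%:Z = nletter i.
Proof. by apply: val_inj; rewrite /= modz_nat. Qed.

Lemma nletter_ord (i : 'I_m) : nletter i = i.
Proof. by apply: val_inj; rewrite /= modn_small. Qed.

Lemma nletterDm i : nletter (i + m) = nletter i.
Proof. by apply: val_inj; rewrite /= modnDr. Qed.

Lemma s_nat (i n : nat) :
  s m_gt0 i%:Z n = [seq (nletter (i + k), true) | k <- iota 0 n].
Proof. by rewrite /s; apply: eq_map => k; rewrite -PoszD letter_nat. Qed.

Lemma weval_s (H : groupType) (f : 'I_m -> H) (i n : nat) :
  weval f (s m_gt0 i%:Z n) = \prod_(k < n) f (nletter (i + k)).
Proof. by rewrite s_nat /weval big_map /= -[n in iota 0 n]subn0 [LHS]big_mkord. Qed.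

Definition cgen (i : nat) : G := pgen _ (nletter i).

Lemma cgen_ord (i : 'I_m) : cgen i = pgen _ i.
Proof. by rewrite /cgen nletter_ord. Qed.

Lemma nletter_circular (H : groupType) (f : 'I_m -> H) :
  (forall i : 'I_m, \prod_(k < l) f (nletter (i + k))
                    = \prod_(k < l) f (nletter (i.+1 + k))) ->
  circular m l (f \o nletter).
Proof.
move=> fR; split=> i /=; first by rewrite nletterDm.
have mod_nl j k : nletter (j %% m + k) = nletter (j + k).
  by apply: val_inj; rewrite /= modnDml.
transitivity (\prod_(k < l) f (nletter (i %% m + k))).
  by apply: eq_bigr => k _; rewrite mod_nl.
rewrite (fR (nletter i)); apply: eq_bigr => k _ /=.
by rewrite addSnnS mod_nl addSnnS.
Qed.

Lemma circular_nletter (H : groupType) (x : nat -> H) i :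
  circular m l x -> x (nletter i) = x i.
Proof.
case=> per _; rewrite [in RHS](divn_eq i m) /= addnC.
elim: (i %/ m) => [|q IHq]; first by rewrite addn0.
by rewrite mulSn addnCA addnC per.
Qed.

Lemma cgen_circular : circular m l cgen.
Proof.
apply: nletter_circular => i.
have prodE (j : nat) :
    \prod_(k < l) pgen (circular_rel m_gt0 l) (nletter (j + k))
    = \pi_(presented (circular_rel m_gt0 l))%qT (s m_gt0 j%:Z l).
  by rewrite s_nat pi_positive -[X in iota 0 X]subn0 [RHS]big_mkord.
rewrite !prodE; apply/presentedP/pres_rel; exists i; split=> //.
by rewrite -addn1 PoszD.
Qed.

Lemma circular_hom (H : groupType) (x : nat -> H) : circular m l x ->
  exists phi : {multiplicative G -> H}, forall i, phi (cgen i) = x i.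
Proof.
move=> cx; have x_mod i := circular_nletter i cx; case: (cx) => _ slide.
have [|phi phiE] := @pres_hom _ (circular_rel m_gt0 l) H (x \o val).
  move=> _ _ [i [-> ->]]; rewrite -[(_ + 1)%R]PoszD addn1 !weval_s /=.
  under eq_bigr do rewrite x_mod.
  by under [RHS]eq_bigr do rewrite x_mod.
by exists phi => i; rewrite /cgen phiE /= x_mod.
Qed.

Lemma circular_hom_eq (H : groupType) (phi psi : {multiplicative G -> H}) :
  (forall i, phi (cgen i) = psi (cgen i)) -> phi =1 psi.
Proof. by move=> eq_gen; apply: pres_hom_eq => i; rewrite -cgen_ord. Qed.

End CircularGroup.

Lemma circular_group_swap m l (m_gt0 : (0 < m)%N) (l_gt0 : (0 < l)%N) :
  isomorphic (circular_group m_gt0 l) (circular_group l_gt0 m).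
Proof.
have [phi phiE] := circular_hom m_gt0 (swap_circular (cgen_circular l_gt0 m)).
have [psi psiE] := circular_hom l_gt0 (swap_circular (cgen_circular m_gt0 l)).
exists phi, psi.
  apply: (circular_hom_eq (phi := psi \o phi) (psi := idfun)) => i /=.
  by rewrite phiE swap_morph (eq_swap psiE) swap_swap.
apply: (circular_hom_eq (phi := phi \o psi) (psi := idfun)) => i /=.
by rewrite psiE swap_morph (eq_swap phiE) swap_swap.
Qed.

Definition zpow (H : groupType) (g : H) (z : int) : H :=
  if z is Negz n then (g ^+ n.+1)^-1 else g ^+ `|z|.

Lemma zpowD1 (H : groupType) (g : H) z : zpow g (z + 1)%R = zpow g z * g.
Proof.
case: z => [n|[|n]]; first by rewrite -PoszD addn1 /= expgSr.
  by rewrite /= expg1 mulVg.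
have ->: (Negz n.+1 + 1)%R = Negz n.
  by rewrite !NegzE -[n.+2]addn1 PoszD opprD subrK.
by rewrite /= [in RHS]expgS invgM mulgVK.
Qed.

Lemma zpowB1 (H : groupType) (g : H) z : zpow g (z - 1)%R = zpow g z * g^-1.
Proof. by rewrite -[z in RHS](subrK 1%R) zpowD1 mulgK. Qed.

(** With a single letter both sides of every relation are the same word, so
    G(1,l) is free on that letter. *)
Lemma circular_group_1 l (one_gt0 : (0 < 1)%N) :
  isomorphic (circular_group one_gt0 l) Zgroup.
Proof.
have [|phi phiE] := @circular_hom 1 one_gt0 l Zgroup (fun=> 1%R : int).
  by split=> // i; apply: eq_bigr.
pose a : circular_group one_gt0 l := cgen one_gt0 l 0.
have genE (i : 'I_1) : pgen (circular_rel one_gt0 l) i = a.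
  by rewrite ord1 /a -cgen_ord.
have phi_a : phi a = (1%R : int) by rewrite phiE.
exists phi; exists (zpow a) => [g|z].
  move: g; apply: pres_ind => [|g x IHg|g x IHg].
  - by rewrite multiplicative1.
  - by rewrite genE gmulfM phi_a (zpowD1 a (phi g)) IHg.
  by rewrite genE gmulfM multiplicativeV phi_a (zpowB1 a (phi g)) IHg.
elim/int_ind: z => [|n IHn|n IHn]; first exact: (multiplicative1 phi).
  by rewrite -[n.+1]addn1 PoszD zpowD1 gmulfM IHn phi_a.
by rewrite -[n.+1]addn1 PoszD opprD zpowB1 gmulfM multiplicativeV IHn phi_a.
Qed.

(** * Paths in normal form *)

Lemma coprime_bezout m l : (0 < m)%N -> coprime m l ->
  exists a b, (a * m = b * l + 1)%N.
Proof.
move=> m_gt0 /eqP co; case: (egcdnP l m_gt0) => a b ab _.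
by exists a, b; rewrite ab co.
Qed.

Section NormalPath.
Variables (H : groupType) (e m1 l1 a b : nat).
Local Notation d := e.+1.
Hypothesis bezout : (a * m1 = b * l1 + 1)%N.
Implicit Types (A B : H) (t : 'I_e -> H).

(** The values P_0 = 1, P_1, ..., P_(d-1) of a path, of which only the last
    d - 1 = e are free; out of bounds the value 1 is arbitrary. *)
Definition base_point t (r : nat) : H :=
  if r is r'.+1 then oapp t 1 (insub r') else 1.

(** Since d = a m - b l for m = m1 d and l = l1 d, a path satisfies
    P_(i+d) = A^a P_i B^-b, and so is determined by its first d values. *)
Definition normal_path A B t (i : nat) : H :=
  A ^+ (a * (i %/ d)) * base_point t (i %% d) * (B ^+ (b * (i %/ d)))^-1.

Lemma base_point_eq t (P : nat -> H) r :
    P 0%N = 1 -> (forall j : 'I_e, t j = P j.+1) -> (r < d)%N ->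
  base_point t r = P r.
Proof. by move=> P0 tP; case: r => //= r; rewrite ltnS => re; rewrite insubT /= tP. Qed.

Lemma base_point_ord t (j : 'I_e) : base_point t j.+1 = t j.
Proof. by rewrite /= valK. Qed.

Lemma normal_path_unique A B t (P : nat -> H) :
    P 0%N = 1 -> (forall i, P (i + m1 * d)%N = A * P i) ->
    (forall i, P (i + l1 * d)%N = P i * B) -> (forall j : 'I_e, t j = P j.+1) ->
  normal_path A B t =1 P.
Proof.
move=> P0 Pm Pl tP i; rewrite /normal_path (base_point_eq P0 tP) ?ltn_mod //.
set q := (i %/ d)%N; set r := (i %% d)%N.
rewrite -(iter_pathl _ _ Pm); apply: (mulIg (B ^+ (b * q))).
rewrite mulgVK -(iter_pathr _ _ Pl); congr P.
have qd_bezout := congr1 (muln (q * d)) bezout.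
by rewrite [in RHS](divn_eq i d) -/q -/r; lia.
Qed.

Section TorusRelations.
Variables (A B : H) (t : 'I_e -> H).
Hypothesis AB : A ^+ l1 = B ^+ m1.
Hypothesis At : forall j, commute (A ^+ l1) (t j).

Lemma normal_path_base r : (r < d)%N -> normal_path A B t r = base_point t r.
Proof.
move=> rd; rewrite /normal_path divn_small // modn_small //.
by rewrite !muln0 !expg0 invg1 mulg1 mul1g.
Qed.

Lemma commute_base_point r : commute (A ^+ l1) (base_point t r).
Proof.
by case: r => [|r] /=; [|case: insubP => [j _ _|_]] => //=; exact: commute1.
Qed.

Lemma base_point_absorb n r :
  (A ^+ l1) ^+ n * base_point t r * ((B ^+ m1) ^+ n)^-1 = base_point t r.
Proof.
by rewrite -AB -(commuteX n (commute_sym (commute_base_point r))) mulgK.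
Qed.

(** Adding m to i adds m1 to its quotient by d, hence b l1 + 1 to the exponent
    of A and b m1 to that of B^-1: one factor A is left over, and the base
    point absorbs all the others. *)
Lemma normal_pathDm i : normal_path A B t (i + m1 * d) = A * normal_path A B t i.
Proof.
rewrite /normal_path divnDMl // [(i + _)%N]addnC modnMDl.
set q := (i %/ d)%N; set r := (i %% d)%N.
have -> : A ^+ (a * (q + m1)) = A * A ^+ (a * q) * (A ^+ l1) ^+ b.
  by rewrite -expgnA -expgS -expgnDr; congr (A ^+ _); lia.
have -> : B ^+ (b * (q + m1)) = B ^+ (b * q) * (B ^+ m1) ^+ b.
  by rewrite -expgnA -expgnDr; congr (B ^+ _); lia.
by rewrite invgM -[in RHS](base_point_absorb b r) !mulgA.
Qed.

Lemma normal_pathDl i : normal_path A B t (i + l1 * d) = normal_path A B t i * B.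
Proof.
rewrite /normal_path divnDMl // [(i + _)%N]addnC modnMDl.
set q := (i %/ d)%N; set r := (i %% d)%N.
have -> : A ^+ (a * (q + l1)) = A ^+ (a * q) * (A ^+ l1) ^+ a.
  by rewrite -expgnA -expgnDr; congr (A ^+ _); lia.
have -> : B ^+ (b * (q + l1)) = B^-1 * (B ^+ (b * q) * (B ^+ m1) ^+ a).
  apply: (canRL (mulKg B)); rewrite -expgnA -expgnDr -expgS; congr (B ^+ _); lia.
by rewrite !invgM invgK -[in RHS](base_point_absorb a r) !mulgA.
Qed.

End TorusRelations.
End NormalPath.

(** * Counting homomorphisms to a finite group *)

Lemma card_in_bij (T U : finType) (A : {set T}) (B : {set U})
    (f : T -> U) (g : U -> T) :
    {in A, forall x, f x \in B} -> {in B, forall y, g y \in A} ->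
    {in A, cancel f g} -> {in B, cancel g f} ->
  #|A| = #|B|.
Proof.
move=> fA gB fK gK; rewrite -(card_in_imset (can_in_inj fK)); apply: eq_card => y.
apply/imsetP/idP => [[x xA ->]|yB]; first exact: fA.
by exists (g y); rewrite ?gK ?gB.
Qed.

Section Representations.
Variable H : finGroupType.

(** The homomorphisms from G(m,l) to H, given by the images of the letters. *)
Definition circular_reps m (m_gt0 : (0 < m)%N) l : {set {ffun 'I_m -> H}} :=
  [set f : {ffun 'I_m -> H} |
     [forall i : 'I_m, \prod_(k < l) f (nletter m_gt0 (i + k))
                    == \prod_(k < l) f (nletter m_gt0 (i.+1 + k))]].

Lemma circular_repsP m (m_gt0 : (0 < m)%N) l (f : {ffun 'I_m -> H}) :
  reflect (circular m l (f \o nletter m_gt0)) (f \in circular_reps m_gt0 l).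
Proof.
apply: (iffP idP); rewrite inE.
  by move/forallP=> fR; apply: nletter_circular => i; apply/eqP.
by case=> _ slide; apply/forallP => i; apply/eqP/slide.
Qed.

(** Precomposition with an isomorphism is an injection between the sets of
    homomorphisms to H. *)
Lemma card_circular_reps_le m (m_gt0 : (0 < m)%N) l m' (m'_gt0 : (0 < m')%N) l' :
  isomorphic (circular_group m'_gt0 l') (circular_group m_gt0 l) ->
  #|circular_reps m_gt0 l| <= #|circular_reps m'_gt0 l'|.
Proof.
case=> h [k hK kK].
have hom (f : {ffun 'I_m -> H}) :
    exists phi : {multiplicative circular_group m_gt0 l -> H},
    f \in circular_reps m_gt0 l ->
    forall i, phi (cgen m_gt0 l i) = f (nletter m_gt0 i).
  have [/circular_repsP/(circular_hom m_gt0)[phi phiE]|nf] := boolP (f \in _).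
    by exists phi.
  suff [phi _] : exists phi : {multiplicative circular_group m_gt0 l -> H},
    forall i, phi (cgen m_gt0 l i) = 1 by exists phi.
  by apply: circular_hom; split=> // i; apply: eq_bigr.
pose phi f := projT1 (cid (hom f)).
have phiE f : f \in circular_reps m_gt0 l ->
    forall i, phi f (cgen m_gt0 l i) = f (nletter m_gt0 i).
  exact: projT2 (cid (hom f)).
pose F f := [ffun i : 'I_m' => phi f (h (cgen m'_gt0 l' i))].
have FE f i : F f (nletter m'_gt0 i) = phi f (h (cgen m'_gt0 l' i)).
  by rewrite ffunE cgen_ord.
have Freps f : F f \in circular_reps m'_gt0 l'.
  apply/circular_repsP; apply: (eq_circular (fun i => esym (FE f i))).
  exact: (circular_morph (phi f \o h) (cgen_circular m'_gt0 l')).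
have Finj : {in circular_reps m_gt0 l &, injective F}.
  move=> f1 f2 f1R f2R F12; apply/ffunP => i.
  have eq_phi : phi f1 \o h =1 phi f2 \o h.
    by apply: circular_hom_eq => j /=; rewrite -!FE F12.
  rewrite -[i](nletter_ord m_gt0) -!phiE // -(kK (cgen m_gt0 l i)).
  exact: eq_phi.
rewrite -(card_in_imset Finj); apply/subset_leq_card/subsetP => _ /imsetP[f _ ->].
exact: Freps.
Qed.

(** The homomorphisms to H from the group
    < A, B, t_1, ..., t_e | A^l1 = B^m1 commutes with every t_j >,
    which for e = 0 is the group of a torus knot. *)
Definition torus_triples e m1 l1 : {set H * H * {ffun 'I_e -> H}} :=
  [set t : H * H * {ffun 'I_e -> H} |
     (t.1.1 ^+ l1 == t.1.2 ^+ m1) && (t.2 \in ffun_on (mem 'C[t.1.1 ^+ l1]))].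

Lemma card_circular_reps_triples e m1 l1 (d := e.+1) (m_gt0 : (0 < m1 * d)%N) :
    (0 < l1)%N -> coprime m1 l1 ->
  #|circular_reps m_gt0 (l1 * d)| = #|torus_triples e m1 l1|.
Proof.
move=> l1_gt0 co_m1l1; set l := (l1 * d)%N.
have m1_gt0 : (0 < m1)%N by move: m_gt0; rewrite muln_gt0 => /andP[].
have [a [b bezout]] := coprime_bezout m1_gt0 co_m1l1.
pose P (f : {ffun 'I_(m1 * d) -> H}) := path_of (f \o nletter m_gt0).
pose F f := (P f (m1 * d)%N, P f l, [ffun j : 'I_e => P f j.+1]).
pose N (t : H * H * {ffun 'I_e -> H}) := normal_path a b t.1.1 t.1.2 t.2.
pose E t := [ffun j : 'I_(m1 * d) => steps (N t) j].
have Pm f : f \in circular_reps m_gt0 l ->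
    forall i, P f (i + m1 * d)%N = P f (m1 * d)%N * P f i.
  by move=> fR i; apply: (@circular_pathl _ _ l); apply/circular_repsP.
have Pl f : f \in circular_reps m_gt0 l ->
    forall i, P f (i + l)%N = P f i * P f l.
  by move=> fR i; apply: (@circular_pathr _ (m1 * d)); apply/circular_repsP.
have tripleP t : t \in torus_triples e m1 l1 ->
    t.1.1 ^+ l1 = t.1.2 ^+ m1 /\ forall j, commute (t.1.1 ^+ l1) (t.2 j).
  rewrite inE => /andP[/eqP AB /ffun_onP Ct]; split=> // j.
  by apply: commute_sym; apply/cent1P; apply: Ct.
have Nm t i : t \in torus_triples e m1 l1 -> N t (i + m1 * d)%N = t.1.1 * N t i.
  by move/tripleP=> [AB Ct]; exact: (normal_pathDm bezout AB Ct).
have Nl t i : t \in torus_triples e m1 l1 -> N t (i + l)%N = N t i * t.1.2.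
  by move/tripleP=> [AB Ct]; exact: (normal_pathDl bezout AB Ct).
have N_circular t : t \in torus_triples e m1 l1 ->
    circular (m1 * d) l (steps (N t)).
  by move=> tT; apply: steps_circular => i; [exact: Nm|exact: Nl].
have N_steps t : t \in torus_triples e m1 l1 ->
    E t \o nletter m_gt0 =1 steps (N t).
  move=> /N_circular cN i; rewrite /= ffunE; exact: circular_nletter cN.
have N0 t : N t 0%N = 1 by apply: normal_path_base.
have PE t : t \in torus_triples e m1 l1 -> P (E t) =1 N t.
  move=> tT i; rewrite -[RHS]mul1g -invg1 -(N0 t) -path_of_steps.
  by apply: eq_bigr => j _; apply: N_steps.
apply: (@card_in_bij _ _ _ _ F E).
- move=> f fR.
  (* Both sides are the value of the path at i + m l1 = i + l m1. *)
  have twist i : P f (m1 * d)%N ^+ l1 * P f i = P f i * P f l ^+ m1.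
    rewrite -(iter_pathl _ _ (Pm _ fR)) -(iter_pathr _ _ (Pl _ fR)).
    by congr (P f (i + _)); rewrite /l; lia.
  have AB : P f (m1 * d)%N ^+ l1 = P f l ^+ m1.
    by have := twist 0%N; rewrite {2 3}/P path_of0 mul1g mulg1.
  rewrite inE /= AB eqxx /=; apply/ffun_onP => j; apply/cent1P.
  by rewrite ffunE /commute -twist AB.
- move=> t tT; apply/circular_repsP.
  by apply: (eq_circular (fun i => esym (N_steps t tT i))); apply: N_circular.
- move=> f fR; apply/ffunP => j; rewrite ffunE.
  have NP : N (F f) =1 P f.
    apply: (normal_path_unique bezout) => /=; first exact: path_of0.
    - by move=> i; apply: Pm.
    - by move=> i; apply: Pl.
    by move=> i; rewrite ffunE.
  by rewrite /steps !NP {2}/P path_ofS mulKg /= nletter_ord.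
- move=> [[A B] t] tT; rewrite /F !PE //.
  have := Nm _ 0%N tT; have := Nl _ 0%N tT; rewrite N0 !add0n mul1g mulg1 => -> ->.
  congr (_, _, _); apply/ffunP => j; rewrite ffunE PE //.
  by rewrite /N normal_path_base ?base_point_ord // ltnS ltn_ord.
Qed.

End Representations.

Definition nroots (H : finGroupType) k (z : H) := #|[set x : H | x ^+ k == z]|.

Lemma card_torus_triples (H : finGroupType) e m1 l1 :
  #|torus_triples H e m1 l1|
  = \sum_(z : H) nroots l1 z * nroots m1 z * #|'C[z]| ^ e.
Proof.
rewrite -sum1_card (partition_big (fun t => t.1.1 ^+ l1) predT) //=.
apply: eq_bigr => z _; rewrite sum1_card -[e in RHS]card_ord.
rewrite -(card_ffun_on 'I_e 'C[z]).
rewrite -[X in _ = (_ * X)%N]cardsE /nroots -!cardsX.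
apply: eq_card => -[[x y] t]; rewrite [in LHS]unfold_in /= !inE /=.
case: (x ^+ l1 =P z) => [->|]; last by rewrite andbF.
by rewrite andbT eq_sym.
Qed.

(** The sum counts the pairs (u, v) with u^l1 = v^m1; as m1 and l1 are coprime,
    these are the pairs (t^m1, t^l1) for a unique t. *)
Lemma sum_nroots (U : finGroupType) m1 l1 :
    abelian [set: U] -> (0 < m1)%N -> coprime m1 l1 ->
  (\sum_(z : U) nroots l1 z * nroots m1 z = #|U|)%N.
Proof.
move=> /centsP abU m1_gt0 co_m1l1.
have cU (x y : U) : commute x y by apply: abU.
have [a [b bezout]] := coprime_bezout m1_gt0 co_m1l1.
transitivity #|[set t : U * U | t.1 ^+ l1 == t.2 ^+ m1]|.
  rewrite -sum1_card (partition_big (fun t => t.1 ^+ l1) predT) //=.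
  apply: eq_bigr => z _; rewrite sum1_card /nroots -!cardsX.
  apply: eq_card => -[x y]; rewrite [in RHS]unfold_in /= !inE /=.
  case: (x ^+ l1 =P z) => [->|]; last by rewrite andbF.
  by rewrite andbT eq_sym.
rewrite -cardsT.
apply: (@card_in_bij _ _ _ _ (fun t => t.1 ^+ a * (t.2 ^+ b)^-1)
                      (fun t => (t ^+ m1, t ^+ l1))) => //.
- by move=> t _; rewrite inE /= -!expgnA mulnC.
- move=> [u v]; rewrite inE /= => /eqP uv; congr (_, _).
    rewrite expgMn // expVgn -!expgnA bezout expgnDr expg1 (mulnC b l1) expgnA uv.
    by rewrite -expgnA (mulnC m1) (cU _ u) mulgK.
  rewrite expgMn // expVgn -!expgnA (mulnC a) expgnA uv -expgnA (mulnC m1) bezout.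
  by rewrite expgnDr expg1 (cU _ v) mulgK.
move=> t _; rewrite /= -!expgnA mulnC bezout expgnDr expg1 (mulnC b).
by rewrite (commute_sym (cU t _)) mulgK.
Qed.

Lemma nroots1_cyclic (U : finGroupType) k : cyclic [set: U] ->
  nroots k (1 : U) = gcdn k #|U|.
Proof.
move=> cU; set g := gcdn k _.
have -> : nroots k (1 : U) = #|'Ldiv_g([set: U])|.
  apply: eq_card => x; rewrite !inE /= -!order_dvdn dvdn_gcd.
  by rewrite -cardsT order_dvdG ?inE ?andbT.
(* Frobenius' theorem gives one divisibility; for the other, the g-torsion is a
   cyclic group of exponent dividing g. *)
apply/eqP; rewrite eqn_dvd; apply/andP; split; last first.
  by apply: Frobenius_Ldiv; rewrite cardsT dvdn_gcdr.
pose K := Group (group_Ldiv g (cyclic_abelian cU)).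
have cK : cyclic K := cyclicS (subsetT K) cU.
by rewrite -(exponent_cyclic cK) -sub_LdivT subsetIr.
Qed.

(** * Roots and centralizers in affine groups *)

Section Affine.
Variables (F : finFieldType) (V : {group {unit F}}).
Local Notation U := (subg_of V).
Local Notation q := #|F|.
Local Notation n := #|{: U}|.

(** The pair (b, u) stands for the map x |-> b + u x, with slope u in V. *)
Definition affine : Type := (F * U)%type.
HB.instance Definition _ := Finite.on affine.

Definition slope (u : U) : F := val (val u).

Lemma slope1 : slope 1 = 1%R. Proof. by []. Qed.
Lemma slopeM u v : slope (u * v) = (slope u * slope v)%R. Proof. by []. Qed.
Lemma slope_inj : injective slope. Proof. by move=> u v /val_inj/val_inj. Qed.

Lemma slopeX (u : U) k : slope (u ^+ k) = (slope u ^+ k)%R.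
Proof. by elim: k => [|k IHk]; rewrite ?expg0 // expgS slopeM IHk exprS. Qed.

Lemma slope_eq1 (u : U) : (slope u == 1%R) = (u == 1).
Proof. exact: (inj_eq slope_inj u 1). Qed.

Definition affine_mul (x y : affine) : affine :=
  ((x.1 + slope x.2 * y.1)%R, x.2 * y.2).
Definition affine_inv (x : affine) : affine :=
  ((- (slope x.2^-1%g * x.1))%R, x.2^-1%g).

Lemma affine_mulA : associative affine_mul.
Proof.
move=> [b u] [c v] [d w]; congr (_, _); last exact: mulgA.
by rewrite /= slopeM mulrDr addrA mulrA.
Qed.

Lemma affine_mul1 : left_id (0%R, 1) affine_mul.
Proof. by case=> b u; congr (_, _); rewrite /= ?mul1g // slope1 mul1r add0r. Qed.

Lemma affine_mulV : left_inverse (0%R, 1) affine_inv affine_mul.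
Proof. by case=> b u; congr (_, _); rewrite /= ?mulVg // addNr. Qed.

HB.instance Definition _ := Finite_isGroup.Build affine
  affine_mulA affine_mul1 affine_mulV.

Local Notation H := affine.

Lemma subg_unit_abelian : abelian [set: U].
Proof.
apply/centsP => u _ v _; apply: slope_inj; rewrite !slopeM; exact: mulrC.
Qed.

Definition geometric k (u : U) : F := (\sum_(i < k) slope u ^+ i)%R.

Lemma affineX (b : F) (u : U) k :
  ((b, u) : H) ^+ k = ((b * geometric k u)%R, u ^+ k).
Proof.
elim: k => [|k IHk]; first by rewrite /geometric big_ord0 mulr0 !expg0.
rewrite expgSr IHk; congr (_, _); last by rewrite /= expgSr.
by rewrite /= slopeX /geometric big_ord_recr /= mulrDr [(b * slope u ^+ k)%R]mulrC.
Qed.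

Lemma geometric_eq0 k (u : U) : (k%:R != 0 :> F)%R ->
  (geometric k u == 0%R) = (u != 1) && (u ^+ k == 1).
Proof.
move=> k0; have [->|u1] := eqVneq u 1.
  rewrite /geometric; under eq_bigr do rewrite expr1n.
  by rewrite sumr_const card_ord (negPf k0).
by rewrite -slope_eq1 slopeX -[RHS]subr_eq0 subrX1 mulf_eq0 subr_eq0 slope_eq1 (negPf u1).
Qed.

Lemma geometric1 k : (k%:R != 0 :> F)%R -> (geometric k 1 == 0%R) = false.
Proof. by move=> k0; rewrite geometric_eq0 // eqxx. Qed.

Lemma card_solutions (s c : F) :
  #|[set b : F | (b * s == c)%R]|
  = if s == 0%R then if c == 0%R then q else 0 else 1%N.
Proof.
have [->|s0] := eqVneq s 0%R; last first.
  rewrite -(cards1 (c / s)%R); apply: eq_card => b; rewrite !inE.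
  exact: (can2_eq (mulfK s0) (divfK s0)).
case: eqP => [->|/eqP c0].
  by rewrite -cardsT; apply: eq_card => b; rewrite !inE mulr0 eqxx.
by apply: eq_card0 => b; rewrite !inE mulr0 eq_sym (negPf c0).
Qed.

Lemma card_affine_set (P : pred H) :
  #|[set x | P x]| = \sum_(u : U) #|[set b : F | P (b, u)]|.
Proof.
rewrite -sum1_card (partition_big (fun x : H => x.2) predT) //=.
apply: eq_bigr => u _; rewrite sum1_card.
have pairI : injective (fun b : F => (b, u) : H) by move=> b c [].
rewrite -(card_imset _ pairI); apply: eq_card => -[b v].
apply/idP/imsetP => /= [|[c]].
  by rewrite unfold_in /= inE => /andP[Pbv /eqP vu]; exists b; rewrite ?inE -?vu.
by rewrite inE => Pc [-> ->]; rewrite unfold_in /= inE Pc eqxx.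
Qed.

(** Once the slope u of a k-th root is chosen, its translation part solves the
    linear equation b (1 + u + ... + u^(k-1)) = c. *)
Lemma nroots_affineE k c (z : U) :
  nroots k ((c, z) : H) = \sum_(u : U | u ^+ k == z)
     (if geometric k u == 0%R then if c == 0%R then q else 0 else 1%N).
Proof.
rewrite /nroots card_affine_set [RHS]big_mkcond /=; apply: eq_bigr => u _.
rewrite -card_solutions; case: ifP => uz.
  by apply: eq_card => b; rewrite !inE affineX xpair_eqE uz andbT.
by apply: eq_card0 => b; rewrite !inE affineX xpair_eqE uz andbF.
Qed.

Lemma nroots_rotation k c (z : U) : (k%:R != 0 :> F)%R -> z != 1 ->
  nroots k ((c, z) : H) = nroots k z.
Proof.
move=> k0 z1; rewrite nroots_affineE /nroots -sum1_card.
under [RHS]eq_bigl do rewrite inE.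
apply: eq_bigr => u /eqP uz; by rewrite geometric_eq0 // uz (negPf z1) andbF.
Qed.

Lemma nroots_translation k c : (k%:R != 0 :> F)%R -> c != 0%R ->
  nroots k ((c, 1) : H) = 1%N.
Proof.
move=> k0 c0; rewrite nroots_affineE (bigD1 1) ?expg1n //=.
rewrite geometric1 // big1 // => u /andP[uk u1].
by rewrite geometric_eq0 // u1 uk (negPf c0).
Qed.

Lemma nroots_affine1 k : (k%:R != 0 :> F)%R ->
  nroots k ((0%R, 1) : H) = (1 + (nroots k (1%g : U)).-1 * q)%N.
Proof.
move=> k0; rewrite nroots_affineE (bigD1 1) ?expg1n //=.
rewrite geometric1 // eqxx; congr (_ + _)%N.
have -> : (nroots k (1 : U)).-1 = #|[set u : U | (u ^+ k == 1) && (u != 1)]|.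
  rewrite /nroots (cardsD1 1) inE expg1n eqxx /=; apply: eq_card => u.
  by rewrite !inE andbC.
rewrite -sum_nat_const; apply: eq_big => [u|u /andP[uk u1]]; first by rewrite inE.
by rewrite geometric_eq0 // u1 uk.
Qed.

Lemma card_cent_affine c (z : U) :
  #|'C[(c, z) : H]| = \sum_(u : U)
    (if z == 1%g then if (c == 0%R) || (u == 1%g) then q else 0 else 1%N).
Proof.
pose y : H := (c, z).
have -> : 'C[y] = [set x : H | x * y == y * x].
  by apply/setP => x; rewrite [RHS]inE; apply/cent1P/eqP.
rewrite card_affine_set; apply: eq_bigr => u _.
have -> : (if z == 1%g then if (c == 0%R) || (u == 1%g) then q else 0 else 1%N)
   = #|[set b : F | b * (slope z - 1) == c * (slope u - 1)]%R|.
  by rewrite card_solutions mulf_eq0 !subr_eq0 !slope_eq1.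
apply: eq_card => b; rewrite !inE xpair_eqE /=.
have -> : u * z == z * u.
  apply/eqP; apply: slope_inj; rewrite !slopeM; exact: mulrC.
rewrite andbT !mulrBr !mulr1 -[LHS]subr_eq0 -[RHS]subr_eq0 -[RHS]oppr_eq0.
by congr (_ == _); ring.
Qed.

Lemma card_cent_rotation c (z : U) : z != 1 -> #|'C[(c, z) : H]| = n.
Proof. by move=> z1; rewrite card_cent_affine (negPf z1) sum_nat_const muln1. Qed.

Lemma card_cent_translation (c : F) : (c != 0)%R -> #|'C[(c, 1) : H]| = q.
Proof.
move=> c0; rewrite card_cent_affine eqxx (negPf c0) /= -big_mkcond /=.
by rewrite (big_pred1 1).
Qed.

Lemma card_cent_affine1 : #|'C[(0%R, 1) : H]| = (q * n)%N.
Proof. by rewrite card_cent_affine !eqxx /= sum_nat_const mulnC. Qed.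

End Affine.

(** The closed form of the number C of homomorphisms, with the subtracted term
    moved to the left.  The terms q n n^e - q (a b) n^e, (q - 1) q^e and the last one
    are the contributions of the z of slope other than 1, of the nontrivial
    translations, and of z = 1. *)
Definition affine_count q n e a b C : Prop :=
  (C + q * (a * b) * n ^ e
   = q * n * n ^ e + q.-1 * q ^ e
     + (1 + a.-1 * q) * (1 + b.-1 * q) * (q * n) ^ e)%N.

Lemma card_affine_triples (F : finFieldType) (V : {group {unit F}}) e m1 l1 :
    (m1%:R != 0 :> F)%R -> (l1%:R != 0 :> F)%R -> coprime m1 l1 ->
  affine_count #|F| #|{: subg_of V}| e
    (nroots l1 (1 : subg_of V)) (nroots m1 (1 : subg_of V))
    #|torus_triples (affine V) e m1 l1|.
Proof.
move=> m0 l0 co_m1l1; rewrite /affine_count.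
set U := subg_of V; set H := affine V.
set a := nroots l1 (1 : U); set b := nroots m1 (1 : U).
set q := #|F|; set n := #|{: U}|.
have m1_gt0 : (0 < m1)%N by case: (m1) m0 => //; rewrite eqxx.
have roots : (\sum_(z : U) nroots l1 z * nroots m1 z = n)%N.
  exact: sum_nroots (subg_unit_abelian V) m1_gt0 co_m1l1.
rewrite card_torus_triples.
pose G (x : H) := (nroots l1 x * nroots m1 x * #|'C[x]| ^ e)%N.
rewrite -/(\sum_(z : H) G z)%N.
have -> : (\sum_(x : H) G x = \sum_(z : U) \sum_(c : F) G (c, z))%N.
  by rewrite exchange_big pair_bigA /=; apply: eq_bigr => -[].
rewrite (bigD1 1) //= (bigD1 0%R) //=.
rewrite /G !nroots_affine1 // card_cent_affine1 -/a -/b -/q -/n.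
rewrite (eq_bigr (fun=> q ^ e)%N) => [|c c0]; last first.
  by rewrite !nroots_translation // card_cent_translation // !mul1n.
rewrite sum_nat_const (cardC1 0%R).
rewrite (eq_bigr (fun z => q * n ^ e * (nroots l1 z * nroots m1 z)))%N => [|z z1]; last first.
  under eq_bigr do rewrite !nroots_rotation // card_cent_rotation //.
  by rewrite sum_nat_const mulnA mulnAC.
rewrite -big_distrr /=; set rest := (\sum_(_ | _) _)%N.
have nE : n = (a * b + rest)%N by rewrite -roots (bigD1 1).
rewrite [X in _ = (_ * X * _ + _ + _)%N]nE.
rewrite [RHS]addnC [X in _ = (_ + X)%N]addnC addnA -!addnA.
apply/eqP; rewrite !eqn_add2l; apply/eqP.
by rewrite mulnDr mulnDl addnC [in LHS](mulnAC q (n ^ e)%N).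
Qed.

(** * Recovering the parameters from the counts *)

Local Open Scope nat_scope.

Lemma sum_prod_pair (a b a' b' : nat) : a + b = a' + b' -> a * b = a' * b' ->
  (a', b') \in [:: (a, b); (b, a)].
Proof.
move=> eqS eqT; have : ((a' - a)%:Z * (a' - b)%:Z = 0)%R by nia.
rewrite !inE !xpair_eqE; nia.
Qed.

(** Expanding the count in terms of T = ab and S = a + b, the difference of two
    equal counts is q n^e times the asserted relation. *)
Lemma affine_count_diff q n e a b a' b' C :
    0 < n -> 1 < q -> 0 < a -> 0 < b -> 0 < a' -> 0 < b' ->
    affine_count q n e a b C -> affine_count q n e a' b' C ->
  ((a * b)%:Z - (a' * b')%:Z = (q ^ e)%:Z *
     (((a + b)%:Z - (a' + b')%:Z) * (1 - q%:Z) + q%:Z * ((a * b)%:Z - (a' * b')%:Z)))%R.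
Proof.
rewrite /affine_count => n0 q1.
case: a => // a _; case: b => // b _; case: a' => // a' _; case: b' => // b' _ /=.
rewrite expnMn => eqC eqC'.
have : 0 < n ^ e by rewrite expn_gt0 n0.
case: q q1 eqC eqC' => // q q1; rewrite /=.
move: (n ^ e) (q.+1 ^ e) => E Q eqC eqC' E0.
apply: (@mulfI _ (q.+1%:Z * E%:Z)%R); first by lia.
lia.
Qed.

(** For e > 0 the previous relation makes q divide T - T', so that T = T' if q
    is large, and then S = S'. *)
Lemma affine_count_pair q n e a b a' b' C :
    0 < n -> 0 < a -> 0 < b -> 0 < a' -> 0 < b' -> 0 < e ->
    a * b < q -> a' * b' < q ->
    affine_count q n e a b C -> affine_count q n e a' b' C ->
  (a', b') \in [:: (a, b); (b, a)].
Proof.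
move=> n0 a0 b0 a'0 b'0 e0 abq a'b'q eqC eqC'.
have q1 : 1 < q by rewrite (leq_ltn_trans _ abq) // muln_gt0 a0.
have key := affine_count_diff n0 q1 a0 b0 a'0 b'0 eqC eqC'.
have eqT : a * b = a' * b'.
  have : (q%:Z %| ((a * b)%:Z - (a' * b')%:Z)%R)%Z.
    by rewrite key dvdz_mulr // dvdzE /= dvdn_exp.
  by rewrite -eqz_mod_dvd !modz_nat !modn_small // => /eqP[].
have eqS : a + b = a' + b'.
  move: key {eqC eqC'}; rewrite eqT subrr mulr0 addr0 => /esym/eqP.
  have qe_gt0 : 0 < q ^ e by rewrite expn_gt0 (ltnW q1).
  rewrite !mulf_eq0 => /orP[|/orP[]]; lia.
exact: sum_prod_pair eqS eqT.
Qed.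

(** For e = 0 the relation reads (q - 1) (T - S) = (q - 1) (T' - S'). *)
Lemma affine_count_excess q n a b a' b' C :
    0 < n -> 1 < q -> 0 < a -> 0 < b -> 0 < a' -> 0 < b' ->
    affine_count q n 0 a b C -> affine_count q n 0 a' b' C ->
  a.-1 * b.-1 = a'.-1 * b'.-1.
Proof.
move=> n0 q1 a0 b0 a'0 b'0 eqC eqC'.
have := affine_count_diff n0 q1 a0 b0 a'0 b'0 eqC eqC'; rewrite expn0 mul1r.
case: a a0 {eqC} => // a _; case: b b0 => // b _.
case: a' a'0 {eqC'} => // a' _; case: b' b'0 => // b' _ /=.
move=> key; suff : ((q%:Z - 1) * ((a * b)%:Z - (a' * b')%:Z) = 0)%R by nia.
by lia.
Qed.

(** A gcd with m' is at most m', and likewise for l', so two positive products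
    (m' - 1) (l' - 1) and (gcd(m',ml) - 1) (gcd(l',ml) - 1) agree only if m' and
    l' both divide m l. *)
Lemma dvdn_prod_of_excess m l m' l' :
    0 < m -> 0 < l -> 1 < m' -> 1 < l' -> coprime m' l' ->
    m.-1 * l.-1 = m'.-1 * l'.-1 ->
    m.-1 * l.-1 = (gcdn m' (m * l)).-1 * (gcdn l' (m * l)).-1 ->
  m' * l' %| m * l.
Proof.
move=> m0 l0 m'1 l'1 co eq1 eq2; rewrite Gauss_dvd //.
have gm : gcdn m' (m * l) <= m' by apply: dvdn_leq; rewrite ?dvdn_gcdl // ltnW.
have gl : gcdn l' (m * l) <= l' by apply: dvdn_leq; rewrite ?dvdn_gcdl // ltnW.
apply/andP; split; apply/gcdn_idPl; nia.
Qed.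

Lemma coprime_pair_of_excess m1 l1 m1' l1' :
    1 < m1 -> 1 < l1 -> 1 < m1' -> 1 < l1' -> coprime m1 l1 -> coprime m1' l1' ->
    (forall n, n %| m1 * l1 * (m1' * l1') ->
       (gcdn m1 n).-1 * (gcdn l1 n).-1 = (gcdn m1' n).-1 * (gcdn l1' n).-1) ->
  (m1', l1') \in [:: (m1, l1); (l1, m1)].
Proof.
move=> m1_gt1 l1_gt1 m1'_gt1 l1'_gt1 co co' excess.
have gcd_l (x y z : nat) : gcdn x (x * y * z) = x.
  by apply/gcdn_idPl; rewrite -mulnA dvdn_mulr.
have gcd_m (x y z : nat) : gcdn y (x * y * z) = y.
  by apply/gcdn_idPl; rewrite mulnAC dvdn_mull.
have eqE : m1.-1 * l1.-1 = m1'.-1 * l1'.-1.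
  have := excess _ (dvdnn _); rewrite gcd_l gcd_m.
  by rewrite [X in gcdn m1' X]mulnC [X in gcdn l1' X]mulnC gcd_l gcd_m.
have eq1 := excess _ (dvdn_mulr (m1' * l1') (dvdnn (m1 * l1))).
have eq2 := excess _ (dvdn_mull (m1 * l1) (dvdnn (m1' * l1'))).
have gl (x y : nat) : gcdn x (x * y) = x by apply/gcdn_idPl/dvdn_mulr.
have gr (x y : nat) : gcdn y (x * y) = y by apply/gcdn_idPl/dvdn_mull.
rewrite gl gr in eq1; rewrite [in RHS]gl [in RHS]gr in eq2.
have eqT : m1 * l1 = m1' * l1'.
  apply/eqP; rewrite eqn_dvd; apply/andP; split.
    by apply: dvdn_prod_of_excess => //; lia.
  by apply: dvdn_prod_of_excess => //; lia.
by apply: sum_prod_pair => //; nia.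
Qed.

(** A power of a prime p > N: it is 1 modulo N for the exponent phi(N), and the
    positive integers up to N are invertible modulo p. *)
Lemma exists_finField N : 0 < N ->
  exists F : finFieldType, [/\ N %| #|F|.-1, N < #|F| &
    forall k, 0 < k <= N -> (k%:R != 0 :> F)%R].
Proof.
move=> N_gt0; have [p ltNp p_pr] := prime_above N.
have tN : 0 < totient N by rewrite totient_gt0.
have [F chF cardF] := pPrimePowerField p_pr tN.
exists F; rewrite cardF; split.
- have coNp : coprime p N by rewrite prime_coprime // gtnNdvd.
  rewrite -subn1 -eqn_mod_dvd ?expn_gt0 ?prime_gt0 //.
  by rewrite (Euler_exp_totient coNp).
- by apply: leq_trans ltNp _; rewrite -{1}[p]expn1 leq_exp2l // prime_gt1.
move=> k /andP[k_gt0 leNk]; rewrite -(dvdn_pcharf chF) gtnNdvd //.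
exact: leq_ltn_trans leNk ltNp.
Qed.

Lemma exists_subgroup_units (F : finFieldType) n : n %| #|F|.-1 ->
  exists V : {group {unit F}}, #|{: subg_of V}| = n /\ cyclic [set: subg_of V].
Proof.
move=> n_dvd; have cU : cyclic [set: {unit F}] := field_unit_group_cyclic _.
exists (Group (group_Ldiv n (cyclic_abelian cU))); split; last first.
  by rewrite -(isog_cyclic (isog_subg _)) field_unit_group_cyclic.
rewrite -cardsT -(card_isog (isog_subg _)) /=.
have := nroots1_cyclic n cU.
rewrite -cardsT card_finField_unit (gcdn_idPl n_dvd) => nE; rewrite -[RHS]nE.
by apply: eq_card => x; rewrite !inE.
Qed.

Lemma card_reps_affine (F : finFieldType) (V : {group {unit F}}) e m1 l1
    (m_gt0 : 0 < m1 * e.+1) (n := #|{: subg_of V}|) :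
    cyclic [set: subg_of V] ->
    (m1%:R != 0 :> F)%R -> (l1%:R != 0 :> F)%R -> coprime m1 l1 ->
  affine_count #|F| n e (gcdn l1 n) (gcdn m1 n)
    #|circular_reps (affine V) m_gt0 (l1 * e.+1)|.
Proof.
move=> cV m0 l0 co_m1l1.
have l1_gt0 : 0 < l1 by case: (l1) l0 => //; rewrite eqxx.
rewrite card_circular_reps_triples // /n -!nroots1_cyclic //.
exact: card_affine_triples.
Qed.

Lemma gcd_decomposition m l : 0 < m -> 0 < l -> exists e m1 l1,
  [/\ m = m1 * e.+1, l = l1 * e.+1, 0 < m1, 0 < l1 & coprime m1 l1].
Proof.
move=> m_gt0 l_gt0; have d_gt0 : 0 < gcdn m l by rewrite gcdn_gt0 m_gt0.
have [dm dl] : gcdn m l %| m /\ gcdn m l %| l by rewrite dvdn_gcdl dvdn_gcdr.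
exists (gcdn m l).-1, (m %/ gcdn m l), (l %/ gcdn m l); rewrite prednK //.
split.
- by rewrite (divnK dm).
- by rewrite (divnK dl).
- by rewrite (divn_gt0 _ d_gt0) (dvdn_leq m_gt0 dm).
- by rewrite (divn_gt0 _ d_gt0) (dvdn_leq l_gt0 dl).
by rewrite /coprime -(eqn_pmul2r d_gt0) mul1n muln_gcdl (divnK dm) (divnK dl).
Qed.

Lemma circular_group_inj m l m' l'
    (m_gt0 : 0 < m) (l_gt0 : 0 < l) (m'_gt0 : 0 < m') (l'_gt0 : 0 < l') :
    isomorphic (circular_group m_gt0 l) (circular_group m'_gt0 l') ->
  (1 \in [:: m; l] /\ 1 \in [:: m'; l']) \/ (m', l') \in [:: (m, l); (l, m)].
Proof.
move=> iso.
have card_eq (H : finGroupType) :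
    #|circular_reps H m_gt0 l| = #|circular_reps H m'_gt0 l'|.
  by apply/eqP; rewrite eqn_leq !card_circular_reps_le //; apply: isomorphic_sym.
have [e [m1 [l1 [mE lE m1_gt0 l1_gt0 co]]]] := gcd_decomposition m_gt0 l_gt0.
have [e' [m1' [l1' [m'E l'E m1'_gt0 l1'_gt0 co']]]] := gcd_decomposition m'_gt0 l'_gt0.
subst m l m' l'; clear iso.
pose N := m1 * l1 * (m1' * l1').
have N_gt0 : 0 < N by rewrite !muln_gt0 m1_gt0 l1_gt0 m1'_gt0.
have dm : m1 %| N by rewrite !dvdn_mulr.
have dl : l1 %| N by rewrite dvdn_mulr // dvdn_mull.
have dm' : m1' %| N by rewrite dvdn_mull // dvdn_mulr.
have dl' : l1' %| N by rewrite !dvdn_mull.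
have [F [N_dvd ltNq F0]] := exists_finField N_gt0.
have unitF k : k %| N -> 0 < k -> (k%:R != 0 :> F)%R.
  by move=> kN k0; rewrite F0 // k0 dvdn_leq.
set q := #|F| in N_dvd ltNq.
have q_gt1 : 1 < q by exact: leq_ltn_trans N_gt0 ltNq.
have count n : n %| N -> exists C, affine_count q n e (gcdn l1 n) (gcdn m1 n) C
                          /\ affine_count q n e' (gcdn l1' n) (gcdn m1' n) C.
  move=> nN; have [V [cardV cV]] := exists_subgroup_units (dvdn_trans nN N_dvd).
  exists #|circular_reps (affine V) m_gt0 (l1 * e.+1)|; split.
    by rewrite -cardV; apply: card_reps_affine => //; apply: unitF.
  by rewrite card_eq -cardV; apply: card_reps_affine => //; apply: unitF.
have eq_e : e' = e.
  have [C []] := count 1 (dvd1n _).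
  rewrite /affine_count !gcdn1 !exp1n !muln1 /= !mul1n.
  have q_gt0 := ltnW q_gt1.
  rewrite -!addnA -!mulSnr prednK // -!expnS.
  move=> -> /addnI.
  by move/eqP; rewrite eqn_exp2l // => /eqP[].
subst e'.
have [e0|e_gt0] := posnP e; last first.
  have [C [eqC eqC']] := count N (dvdnn N).
  move: eqC eqC'; rewrite !(gcdn_idPl _) // => eqC eqC'.
  have : (l1', m1') \in [:: (l1, m1); (m1, l1)].
    apply: affine_count_pair eqC eqC' => //; apply: leq_ltn_trans ltNq.
      by rewrite mulnC leq_pmulr // muln_gt0 m1'_gt0.
    by rewrite mulnC leq_pmull // muln_gt0 m1_gt0.
  by rewrite !inE !xpair_eqE => /orP[]/andP[/eqP -> /eqP ->]; right; rewrite !eqxx ?orbT.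
subst e; rewrite !muln1.
have excess n : n %| N ->
    (gcdn m1 n).-1 * (gcdn l1 n).-1 = (gcdn m1' n).-1 * (gcdn l1' n).-1.
  move=> nN; have n_gt0 : 0 < n by apply: dvdn_gt0 nN.
  have [C [eqC eqC']] := count n nN.
  rewrite mulnC [RHS]mulnC.
  by apply: affine_count_excess eqC eqC' => //; rewrite gcdn_gt0 n_gt0 orbT.
have := excess N (dvdnn N); rewrite !(gcdn_idPl _) // => eqE.
have mem1 (x y : nat) : 0 < x -> 0 < y -> (1 \in [:: x; y]) = ~~ (0 < x.-1 * y.-1).
  by case: x => [|[|x]] //; case: y => [|[|y]] //= _ _; rewrite ?muln0 ?inE.
have [one|] := boolP (1 \in [:: m1; l1]).
  by left; split=> //; move: one; rewrite !mem1 // eqE.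
rewrite mem1 // negbK => pos; have pos' := pos; rewrite eqE in pos'; right.
move: pos pos'; rewrite !muln_gt0 -!subn1 !subn_gt0.
move=> /andP[m1_gt1 l1_gt1] /andP[m1'_gt1 l1'_gt1].
exact: coprime_pair_of_excess excess.
Qed.

Theorem corollary2p21 (m l m' l' : nat)
    (m_gt0 : (0 < m)%N) (l_gt0 : (0 < l)%N)
    (m'_gt0 : (0 < m')%N) (l'_gt0 : (0 < l')%N) :
  (isomorphic (circular_group m_gt0 l) (circular_group m'_gt0 l')
     <-> (1%N \in [:: m; l] /\ 1%N \in [:: m'; l'])
         \/ (m', l') \in [:: (m, l); (l, m)])
  /\ (1%N \in [:: m; l] /\ 1%N \in [:: m'; l'] ->
        isomorphic (circular_group m_gt0 l) (circular_group m'_gt0 l')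
        /\ isomorphic (circular_group m'_gt0 l') Zgroup).
Proof.
have isoZ k p (k_gt0 : 0 < k) : 0 < p -> 1 \in [:: k; p] ->
    isomorphic (circular_group k_gt0 p) Zgroup.
  move=> p_gt0; rewrite !inE => /orP[]/eqP one.
    by subst k; exact: circular_group_1.
  subst p; apply: isomorphic_trans (circular_group_swap k_gt0 p_gt0) _.
  exact: circular_group_1.
have both : 1 \in [:: m; l] /\ 1 \in [:: m'; l'] ->
    isomorphic (circular_group m_gt0 l) (circular_group m'_gt0 l')
    /\ isomorphic (circular_group m'_gt0 l') Zgroup.
  move=> [/(isoZ _ _ m_gt0 l_gt0) isoG /(isoZ _ _ m'_gt0 l'_gt0) isoG']; split=> //.
  exact: isomorphic_trans isoG (isomorphic_sym isoG').
split=> //; split; first exact: circular_group_inj.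
case=> [/both[]//|]; rewrite !inE !xpair_eqE => /orP[]/andP[/eqP eqm /eqP eql]; subst m' l'.
  by rewrite (bool_irrelevance m'_gt0 m_gt0); exists idfun; exists idfun.
by rewrite (bool_irrelevance m'_gt0 l_gt0); apply: circular_group_swap.
Qed.
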